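(* For every integer $r\geq 2$, the graph $H_{4, 4^r}$ is integral, i.e., every eigenvalue of $H_{4,4^r}$ is an integer.
   Context: For an integer $r\ge 1$, the Galois ring of characteristic $4$ and order $4^r$ is $GR(4,4^r) := \mathbb{Z}_4[x]/(f(x))$, where $\mathbb{Z}_4=\mathbb{Z}/4\mathbb{Z}$ and $f(x)\in\mathbb{Z}_4[x]$ is a monic polynomial of degree $r$ whose reduction modulo $2$ is irreducible over $\mathbb{Z}_2$ (up to isomorphism, the ring does not depend on $f$). $GR^+(4,4^r)$ and $GR^*(4,4^r)$ denote its additive group and its group of units. $GR^*(4,4^r)$ contains a unique subgroup $G_1$ of order $2^r-1$, which is cyclic. For an additively written group $\Gamma$ and $S\subset\Gamma\setminus\{0\}$ with $S=-S$, the Cayley graph $Cay(\Gamma,S)$ has vertex set $\Gamma$, with $x,y$ adjacent if and only if $x-y\in S$. For $r\ge 2$ define $H_{4,4^r} := Cay(GR^+(4,4^r), G_1\cup -G_1)$. Eigenvalues of a graph are the eigenvalues of its adjacency matrix. A graph is called integral if all its eigenvalues are integers. *)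

(* Defs.v *)
From HB Require Import structures.
From mathcomp Require Import all_boot all_order all_fingroup all_algebra.

Set Implicit Arguments.
Unset Strict Implicit.
Unset Printing Implicit Defensive.

Import GRing.Theory.
Local Open Scope ring_scope.

Definition Cay (Gamma : finZmodType) (S : {set Gamma}) : rel Gamma :=
  fun x y => x - y \in S.

(* The adjacency matrix is indexed by the enumeration of the vertex type. *)
Definition adjacency_mx (C : nzRingType) (V : finType) (e : rel V) : 'M[C]_#|V| :=
  \matrix_(i, j) (e (enum_val i) (enum_val j))%:R.

(* C is the field in which eigenvalues are taken; as it is algebraically
   closed, no eigenvalue is missed. *)
Definition integral_graph (C : numClosedFieldType) (V : finType) (e : rel V) : Prop :=
  forall a : C, eigenvalue (adjacency_mx C e) a -> exists m : int, a = m%:~R.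

Definition mod2 (a : 'Z_4) : 'F_2 := (a : nat)%:R.

Definition basic_irreducible (r : nat) (f : {poly 'Z_4}) : Prop :=
  [/\ f \is monic, size f = r.+1 & irreducible_poly (map_poly mod2 f)].

(* Z_4[x]/(f).  The alias carries the unit structure of a finite ring, which
   {poly %/ f} only has when the coefficients form a field.  {poly %/ f} is the
   quotient by f only when f is monic and nonconstant, which basic_irreducible
   guarantees for r > 0. *)
Definition galois_ring (f : {poly 'Z_4}) : predArgType := {poly %/ f}.

HB.instance Definition _ (f : {poly 'Z_4}) := GRing.ComNzRing.on (galois_ring f).
HB.instance Definition _ (f : {poly 'Z_4}) := Finite.on (galois_ring f).
HB.instance Definition _ (f : {poly 'Z_4}) := FinRing.isNzRing.Build (galois_ring f).

Lemma card_galois_ring (r : nat) (f : {poly 'Z_4}) :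
  (0 < r)%N -> basic_irreducible r f -> #|galois_ring f| = (4 ^ r)%N.
Proof.
by move=> r0 [fm sf _]; rewrite card_monic_qpoly ?sf ?card_ord.
Qed.

Section ConnectionSet.
Variables (R : finUnitRingType) (G : {set {unit R}}).

Definition connection_set : {set R} :=
  [set val u | u in G] :|: [set - val u | u in G].

Lemma connection_set0 : 0 \notin connection_set.
Proof.
rewrite inE negb_or; apply/andP; split; apply/imsetP => -[u _] /eqP.
  by rewrite eq_sym => /eqP u0; have := valP u; rewrite /= u0 unitr0.
by rewrite eq_sym oppr_eq0 => /eqP u0; have := valP u; rewrite /= u0 unitr0.
Qed.

Lemma connection_setN (x : R) : (- x \in connection_set) = (x \in connection_set).
Proof.
suff main y : y \in connection_set -> - y \in connection_set.
  by apply/idP/idP => /main; rewrite ?opprK.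
rewrite !inE => /orP[] /imsetP[u uG ->]; apply/orP; [right|left];
  by apply/imsetP; exists u; rewrite ?opprK.
Qed.

End ConnectionSet.

Definition H_graph (f : {poly 'Z_4}) (G1 : {set {unit galois_ring f}}) :
  rel (galois_ring f) := Cay (connection_set G1).

(* Main.v *)
(** The additive group of the Galois ring has exponent 4.  On any finite abelian
    group of exponent 4 translations commute and have order dividing 4, so each
    eigenspace of a Cayley graph contains a common eigenfunction of all
    translations, whose eigenvalues [chi s] are fourth roots of unity.  The graph
    eigenvalue is then the sum of [chi s] over the connection set: a Gaussian
    integer, and a real one because [chi (- s)] is conjugate to [chi s]. *)
Require Import Defs.
From mathcomp Require Import all_boot all_order all_fingroup all_algebra.
From mathcomp Require Import ring.

Set Implicit Arguments.
Unset Strict Implicit.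
Unset Printing Implicit Defensive.

Import Order.TTheory GRing.Theory Num.Theory.
Local Open Scope ring_scope.

Section ExponentFour.
Variables (C : numClosedFieldType) (V : finZmodType).
Hypothesis V4 : forall x : V, x *+ 4 = 0.

Definition cayley_eigenfunction (S : {set V}) (a : C) (h : V -> C) :=
  (exists x, h x != 0) /\ forall x, \sum_(s in S) h (x + s) = a * h x.

Lemma adjacency_eigenfunction (S : {set V}) (a : C) :
  eigenvalue (adjacency_mx C (Cay S)) a ->
  exists h, cayley_eigenfunction S a h.
Proof.
move=> /eigenvalueP[v vA v0]; exists (fun x => v 0 (enum_rank x)); split.
  by have /rV0Pn[i vi] := v0; exists (enum_val i); rewrite enum_valK.
move=> x; have /matrixP/(_ 0 (enum_rank x)) := vA.
rewrite !mxE => <-.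
rewrite (reindex enum_rank) /=; last first.
  by exists enum_val => y _; rewrite ?enum_rankK ?enum_valK.
(* Eigenvectors are row vectors here: column [x] picks out the [y] with [y - x \in S], that is
   [y = x + s]. *)
rewrite [RHS](reindex_inj (addrI x)) /= big_mkcond /=.
apply: eq_bigr => s _; rewrite mxE !enum_rankK /Cay addrAC subrr add0r.
by case: ifP => _; rewrite ?mulr1 ?mulr0.
Qed.

Definition translation_eigenfunction (h : V -> C) (g : V) (z : C) :=
  forall x, h (x + g) = z * h x.

(* If [T] is the translation by [g] and [\prod_(z <- zs) (T - z)] kills [h], then
   the last nonzero [\prod_(z <- zs') (T - z) h], for [zs'] a prefix of [zs], is
   an eigenfunction of [T]; it inherits whatever commutes with [T]. *)
Lemma translation_split (S : {set V}) (a : C) (g : V) (zs : seq C) (h : V -> C) :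
    cayley_eigenfunction S a h ->
    (forall x, foldl (fun k z y => k (y + g) - z * k y) h zs x = 0) ->
  exists k, [/\ cayley_eigenfunction S a k,
    exists2 z, z \in zs & translation_eigenfunction k g z
    & forall b z, translation_eigenfunction h b z ->
        translation_eigenfunction k b z].
Proof.
elim: zs h => [|z zs IH] h [[x0 hx0] hS] /= hzs.
  by rewrite hzs eqxx in hx0.
have [/forallP kill|/forallPn[y hy]] :=
    boolP [forall x, h (x + g) - z * h x == 0].
  exists h; split => //; first by split => //; exists x0.
  exists z; first by rewrite mem_head.
  by move=> x; apply/eqP; rewrite -subr_eq0.
have [|k [kS [w wzs kw] kT]] := IH (fun x => h (x + g) - z * h x) _ hzs.
  split; first by exists y.
  move=> x; rewrite big_split /= sumrN -mulr_sumr hS.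
  under eq_bigr => s _ do rewrite addrAC.
  by rewrite hS mulrBr mulrCA.
exists k; split => //; first by exists w; rewrite // in_cons wzs orbT.
by move=> b c hb; apply: kT => x; rewrite addrAC !hb mulrBr (mulrCA z).
Qed.

Definition fourth_roots : seq C := [:: 1; -1; 'i; - 'i].

(** As [(X - 1)(X + 1)(X - i)(X + i) = X^4 - 1], the fold is [T^4 - 1] for [T] the translation by
    [g], and [T^4 = 1] because [g *+ 4 = 0]. *)
Lemma translation_killed (g : V) (h : V -> C) (x : V) :
  foldl (fun k z y => k (y + g) - z * k y) h fourth_roots x = 0.
Proof.
have x4g : x + g + g + g + g = x.
  by rewrite -[RHS]addr0 -(V4 g) !mulrS mulr0n addr0 !addrA.
rewrite /= x4g.
ring: (sqrCi C).
Qed.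

Lemma common_eigenfunction (S : {set V}) (a : C) (h : V -> C) :
    cayley_eigenfunction S a h ->
  exists2 k, cayley_eigenfunction S a k
    & forall g, exists2 z, z \in fourth_roots & translation_eigenfunction k g z.
Proof.
move=> hS.
suff [k kS kT] : exists2 k, cayley_eigenfunction S a k & forall g,
    g \in enum V -> exists2 z, z \in fourth_roots & translation_eigenfunction k g z.
  by exists k => // g; apply: kT; rewrite mem_enum.
(* Translations are treated one at a time; the last clause of [translation_split] keeps the
   eigenvalues already obtained. *)
elim: (enum V) => [|g s [k kS kT]]; first by exists h.
have [l [lS lg lT]] := translation_split kS (translation_killed g k).
exists l => // b; rewrite in_cons => /predU1P[-> //|/kT[z z4 /lT]].
by exists z.
Qed.

Lemma fourth_root_conj (z : C) : z \in fourth_roots -> z^-1 = z^*.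
Proof.
rewrite !inE => /or4P[] /eqP->.
- by rewrite invr1 rmorph1.
- by rewrite invrN invr1 rmorphN rmorph1.
- by rewrite invCi conjCi.
- by rewrite invrN invCi rmorphN /= conjCi.
Qed.

Lemma sum_fourth_roots (I : finType) (S : {set I}) (chi : I -> C) :
    (forall s, chi s \in fourth_roots) ->
  exists m n : int, \sum_(s in S) chi s = m%:~R + 'i * n%:~R.
Proof.
move=> chi4; apply: (big_ind (fun z => exists m n : int, z = m%:~R + 'i * n%:~R)).
- by exists 0, 0; rewrite mulr0 addr0.
- move=> _ _ [m [n ->]] [p [q ->]]; exists (m + p), (n + q).
  by rewrite !rmorphD mulrDr addrACA.
move=> s _; have := chi4 s; rewrite !inE => /or4P[] /eqP->.
- by exists 1, 0; rewrite mulr0 addr0.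
- by exists (-1), 0; rewrite mulr0 addr0 rmorphN.
- by exists 0, 1; rewrite mulr1 add0r.
- by exists 0, (-1); rewrite rmorphN mulrN1 add0r.
Qed.

Lemma integral_Cay (S : {set V}) :
  (forall x, (- x \in S) = (x \in S)) -> integral_graph C (Cay S).
Proof.
move=> SN a /adjacency_eigenfunction[h /common_eigenfunction[k [[x kx] kS] kT]].
pose chi s := k (x + s) / k x.
have chiE s z : translation_eigenfunction k s z -> chi s = z.
  by move=> ksz; rewrite /chi ksz mulfK.
have chi4 s : chi s \in fourth_roots.
  by have [z z4 /chiE->] := kT s.
have chiN s : chi (- s) = (chi s)^*.
  rewrite -fourth_root_conj //.
  have [z _ ksz] := kT s; rewrite (chiE _ _ ksz).
  (* At [x - s] the relation for [s] reads [k x = z * k (x - s)], so [chi (- s) = z^-1]. *)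
  have := ksz (x - s); rewrite subrK => kxz.
  have z0 : z != 0 by apply: contraNneq kx => z0; rewrite kxz z0 mul0r.
  by rewrite /chi; apply: (mulfI z0); rewrite mulrA -kxz !divff.
have aE : a = \sum_(s in S) chi s by rewrite -mulr_suml kS mulfK.
have aR : a \is Num.real.
  (* Conjugating the sum amounts to replacing [s] by [- s], which permutes [S]. *)
  rewrite CrealE aE rmorph_sum /= (reindex_inj oppr_inj) /=; apply/eqP.
  by apply: eq_big => s; rewrite ?SN // -chiN opprK.
have [m [n amn]] := sum_fourth_roots S chi4.
rewrite -aE in amn; exists m.
by rewrite -(Creal_ReP _ aR) amn Re_rect ?realz.
Qed.

End ExponentFour.

Lemma galois_ring_mul4 (f : {poly 'Z_4}) (x : galois_ring f) : x *+ 4 = 0.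
Proof.
(* The ascription to [{poly %/ f}] recovers the scaling by ['Z_4], where [4 = 0]; the alias does not
   carry it. *)
have -> : x *+ 4 = (4%:R : 'Z_4) *: (x : {poly %/ f}) by rewrite scaler_nat.
by rewrite (_ : 4%:R = 0) ?scale0r //; apply: val_inj.
Qed.

Theorem theorem5p1 (C : numClosedFieldType) (r : nat) (f : {poly 'Z_4})
    (G1 : {group {unit galois_ring f}}) :
  (2 <= r)%N -> basic_irreducible r f -> #|G1| = (2 ^ r - 1)%N ->
  integral_graph C (H_graph G1).
Proof.
move=> _ _ _; apply: integral_Cay; first exact: galois_ring_mul4.
exact: connection_setN.
Qed.
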